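(* Let $n\geq 3$ be an integer and let $p(z)=z^n+a_{n-1}z^{n-1}+a_{n-2}z^{n-2}+\ldots+a_1z+a_0$ be a monic polynomial with complex coefficients and $a_0\neq 0$. If $z\in\mathbb{C}$ is any zero of $p$, then \[|z|^2 \leq \cos^2 \frac{\pi}{n+1}+|a_{n-2}|+ \frac{1}{4} \left ( |a_{n-1}|+ \sqrt{ \sum_{j=0}^{n-1}|a_j|^2}\right)^2 + \frac{1}{2}\sqrt{\sum_{j=0}^{n-2}|a_j|^2}+ \frac{1}{2}\sqrt{ \sum_{j=0}^{n-1}|a_j|^2}.\] *)

(* Defs.v *)
From mathcomp Require Import all_boot all_order all_algebra.
From mathcomp Require Import complex.
From mathcomp Require Import reals trigo.

(* Main.v *)
(* With C = L + e_1 r the companion matrix (L the nilpotent shift), z^2 is an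
   eigenvalue of C^2 = L^2 + (e_1 r)^2 + L e_1 r + e_1 r L, so |z|^2 is at most
   the sum of the numerical radii of the four terms: w(L) = cos (pi / (n+1)),
   w(L^2) <= w(L)^2, and the other three are of rank one, where
   w(x y^* ) = (|<x, y>| + |x| |y|) / 2.  Testing on the eigenvector
   (1, z, .., z^(n-1)) only involves the moduli |z|^j, so all the numerical
   radius bounds are needed for real quadratic forms only. *)
Require Import Defs.
From mathcomp Require Import all_boot all_order all_algebra.
From mathcomp Require Import complex.
From mathcomp Require Import reals trigo.
From mathcomp Require Import ring lra.

Import Order.TTheory GRing.Theory Num.Theory.
Local Open Scope ring_scope.
Local Open Scope complex_scope.

(** Cauchy-Schwarz: the squared distance from [f] to its projection [s * y] equals [F - s ^+ 2],
    hence [s ^+ 2 <= F]. *)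
Lemma sum_mul_le_norm (R : rcfType) (n : nat) (f y : nat -> R) :
  \sum_(0 <= j < n) y j ^+ 2 = 1 ->
  \sum_(0 <= j < n) f j * y j <= Num.sqrt (\sum_(0 <= j < n) f j ^+ 2).
Proof.
move=> y1; set F := \sum_(0 <= j < n) f j ^+ 2.
have expand c : \sum_(0 <= j < n) (f j - c * y j) ^+ 2
    = F - 2 * c * (\sum_(0 <= j < n) f j * y j) + c ^+ 2.
  have -> : c ^+ 2 = c ^+ 2 * \sum_(0 <= j < n) y j ^+ 2 by rewrite y1 mulr1.
  rewrite !mulr_sumr -sumrB -big_split /=.
  by apply: eq_bigr => j _; ring.
set s := \sum_(0 <= j < n) f j * y j in expand *.
suff sF : s ^+ 2 <= F by rewrite (le_trans (ler_norm _)) // -sqrtr_sqr ler_wsqrtr.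
have : 0 <= \sum_(0 <= j < n) (f j - s * y j) ^+ 2.
  by apply: sumr_ge0 => j _; apply: sqr_ge0.
by rewrite expand -[s ^+ 2 <= _]subr_ge0; congr (_ <= _); ring.
Qed.

(** Numerical radius of a rank-one form with a basis vector as one factor: a reflection sends that
    vector to a unit vector [y], and Cauchy-Schwarz bounds the pairing of [f] with [y]. *)
Lemma rank_one_form_le (R : rcfType) (n k : nat) (f t : nat -> R) :
  (k < n)%N ->
  (\sum_(0 <= j < n) f j * t j) * t k <=
  (f k + Num.sqrt (\sum_(0 <= j < n) f j ^+ 2)) / 2
    * \sum_(0 <= j < n) t j ^+ 2.
Proof.
move=> kn; set T := \sum_(0 <= j < n) t j ^+ 2.
set al := Num.sqrt _; set s := \sum_(0 <= j < n) f j * t j.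
have T_ge0 : 0 <= T by apply: sumr_ge0 => j _; apply: sqr_ge0.
have sum_delta (g : nat -> R) : \sum_(0 <= j < n) (j == k)%:R * g j = g k.
  rewrite (bigD1_seq k) ?mem_index_iota ?iota_uniq //= eqxx mul1r big1 ?addr0 //.
  by move=> j /negbTE ->; rewrite mul0r.
have [T0|T_neq0] := eqVneq T 0.
  have : t k ^+ 2 <= T.
    by rewrite -(sum_delta (fun j => t j ^+ 2)); apply: ler_sum => j _;
       case: (j == k); rewrite ?mul1r // mul0r sqr_ge0.
  rewrite T0 mulr0 => tk; have /eqP : t k ^+ 2 = 0.
    by apply/le_anti; rewrite tk sqr_ge0.
  by rewrite sqrf_eq0 => /eqP ->; rewrite mulr0.
have T_gt0 : 0 < T by rewrite lt_def T_neq0.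
(* The reflection of the k-th basis vector in the line spanned by t. *)
pose y j := 2 * t k / T * t j - (j == k)%:R.
have : \sum_(0 <= j < n) f j * y j <= al.
  apply: sum_mul_le_norm.
  transitivity ((2 * t k / T) ^+ 2 * (\sum_(0 <= j < n) t j ^+ 2)
      - (\sum_(0 <= j < n) (j == k)%:R * (2 * (2 * t k / T) * t j))
      + \sum_(0 <= j < n) (j == k)%:R * 1).
    rewrite mulr_sumr -sumrB -big_split /=; apply: eq_bigr => j _.
    by rewrite /y; case: (j == k) => /=; ring.
  by rewrite !sum_delta -/T; field.
have -> : \sum_(0 <= j < n) f j * y j = 2 * t k / T * s - f k.
  rewrite -[in RHS](sum_delta f) mulr_sumr -sumrB; apply: eq_bigr => j _.
  by rewrite /y; ring.
rewrite lerBlDr -(ler_pM2r T_gt0).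
have -> : 2 * t k / T * s * T = 2 * (s * t k) by field.
lra.
Qed.

Section Shift.
Variables (R : realType) (n : nat).
Hypothesis n_gt0 : (0 < n)%N.
Let th : R := pi / n.+1%:R.
Let c := cos th.

Let sin_three_term m :
  sin (m%:R * th) + sin (m.+2%:R * th) = 2 * c * sin (m.+1%:R * th).
Proof.
have -> : m%:R * th = m.+1%:R * th - th by rewrite -natr1; ring.
have -> : m.+2%:R * th = m.+1%:R * th + th by rewrite -[m.+2%:R]natr1; ring.
by rewrite sinB sinD -/c; ring.
Qed.

Let sin_mul_gt0 m : (0 < m <= n)%N -> 0 < sin (m%:R * th).
Proof.
move=> /andP[m0 mn]; apply: sin_gt0_pi; rewrite /th mulrA.
rewrite divr_gt0 ?mulr_gt0 ?pi_gt0 ?ltr0n //=.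
by rewrite ltr_pdivrMr ?ltr0n // mulrC ltr_pM2l ?pi_gt0 // ltr_nat ltnS.
Qed.

(* The weights sin (m th) form the Perron eigenvector of the path on n vertices. *)
Lemma shift_form_partial (u : nat -> R) m : (m < n)%N ->
  2 * \sum_(0 <= j < m) u j * u j.+1 <=
  2 * c * \sum_(0 <= j < m) u j ^+ 2
    + u m ^+ 2 * (sin (m%:R * th) / sin (m.+1%:R * th)).
Proof.
elim: m => [|m IH] mn.
  by rewrite !big_nil !mulr0 mul0r sin0 mul0r mulr0 addr0.
rewrite !big_nat_recr //= !mulrDr.
have s1 := sin_mul_gt0 m.+1 (ltnW mn).
have s2 := sin_mul_gt0 m.+2 mn.
have key := sin_three_term m.
have {IH} := IH (ltnW mn).
set s := sin (m%:R * th) in key *.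
set a := sin (m.+1%:R * th) in s1 key *.
set b := sin (m.+2%:R * th) in s2 key *.
(* In the new term [2 * c * u m ^+ 2], the part [s / a] absorbs the boundary term of the induction
   hypothesis and [b / a] feeds the square below. *)
have -> : 2 * c = s / a + b / a by rewrite -mulrDl key mulfK // gt_eqF.
have : 0 <= (u m * b - u m.+1 * a) ^+ 2 / (a * b).
  by apply: divr_ge0; [apply: sqr_ge0 | apply: ltW; apply: mulr_gt0].
have -> : (u m * b - u m.+1 * a) ^+ 2 / (a * b)
   = u m ^+ 2 * (b / a) + u m.+1 ^+ 2 * (a / b) - 2 * (u m * u m.+1).
  by field; rewrite !gt_eqF.
lra.
Qed.

(** The partial bound at [m = n - 1]: since [sin (n.+1%:R * th) = sin pi = 0], the boundary ratio is
    [2 * c], which supplies the missing last square. *)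
Lemma shift_form_le (u : nat -> R) : u n = 0 ->
  \sum_(0 <= j < n) u j * u j.+1 <= c * \sum_(0 <= j < n) u j ^+ 2.
Proof.
move=> un; have [m nE] : exists m, n = m.+1 by exists n.-1; rewrite prednK.
have mn : (m < n)%N by rewrite nE.
have := shift_form_partial u m mn.
have s1 := sin_mul_gt0 m.+1 mn.
have -> : sin (m%:R * th) = 2 * c * sin (m.+1%:R * th).
  rewrite -sin_three_term -nE /th.
  have -> : n.+1%:R * (pi / n.+1%:R) = pi :> R by rewrite mulrC divfK ?pnatr_eq0.
  by rewrite sinpi addr0.
rewrite mulfK ?gt_eqF // nE !big_nat_recr //= -nE un mulr0 addr0.
lra.
Qed.

(* Berger's power inequality in degree 2, from I - A^2 = (I - A)(I + A):
   with u = (c t + L t) / 2 and v = (c t - L t) / 2,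
   <(c^2 - L^2) t, c t> = 2 <(c - L) u, u> + 2 <(c + L) v, v>.
   The signs (-1)^j conjugate L into -L. *)
Lemma shift_sqr_form_le (t : nat -> R) : 0 < c -> t n = 0 -> t n.+1 = 0 ->
  \sum_(0 <= j < n) t j * t j.+2 <= c ^+ 2 * \sum_(0 <= j < n) t j ^+ 2.
Proof.
move=> c_gt0 tn tn1.
pose u j := (c * t j + t j.+1) / 2.
pose v j := (-1) ^+ j * ((c * t j - t j.+1) / 2).
have u0 : u n = 0 by rewrite /u tn tn1; ring.
have v0 : v n = 0 by rewrite /v tn tn1; ring.
have Hu := shift_form_le _ u0; have Hv := shift_form_le _ v0.
rewrite -(ler_pM2l c_gt0) -subr_ge0.
suff -> : c * (c ^+ 2 * \sum_(0 <= j < n) t j ^+ 2)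
          - c * \sum_(0 <= j < n) t j * t j.+2
  = 2 * (c * (\sum_(0 <= j < n) u j ^+ 2) - \sum_(0 <= j < n) u j * u j.+1)
    + 2 * (c * (\sum_(0 <= j < n) v j ^+ 2) - \sum_(0 <= j < n) v j * v j.+1).
  by lra.
rewrite !mulrBr !mulr_sumr -!sumrB -big_split /=; apply: eq_bigr => j _.
have sq : ((-1) ^+ j : R) ^+ 2 = 1 by rewrite sqrr_sign.
rewrite /v [(-1) ^+ j.+1]exprS.
have -> : (-1) ^+ j * ((c * t j - t j.+1) / 2) *
  (-1 * (-1) ^+ j * ((c * t j.+1 - t j.+2) / 2)) =
  - (((-1) ^+ j) ^+ 2 * ((c * t j - t j.+1) / 2 * ((c * t j.+1 - t j.+2) / 2))).
  by ring.
by rewrite [((-1) ^+ j * _) ^+ 2]exprMn sq /u; field.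
Qed.

End Shift.

Lemma normcX (R : rcfType) (z : R[i]) k :
  Normc.normc (z ^+ k) = Normc.normc z ^+ k.
Proof.
by elim: k => [|k IH]; rewrite ?expr0 ?Normc.normc1 // !exprS Normc.normcM IH.
Qed.

Lemma normc_ge0 (R : rcfType) (z : R[i]) : 0 <= Normc.normc z.
Proof. by case: z => a b; apply: sqrtr_ge0. Qed.

Lemma normc_sum_le (R : rcfType) (n : nat) (F : nat -> R[i]) :
  Normc.normc (\sum_(0 <= j < n) F j) <= \sum_(0 <= j < n) Normc.normc (F j).
Proof.
elim: n => [|n IH]; first by rewrite !big_nil Normc.normc0.
rewrite !big_nat_recr //=; apply: le_trans (le_normcD _ _) _.
by rewrite lerD2r.
Qed.

(** Triangle inequality in [z ^+ n = - (lower terms)]; from here on only moduli enter. *)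
Lemma normc_root_le (R : rcfType) (n : nat) (p : {poly R[i]}) (z : R[i]) :
  p \is monic -> size p = n.+1 -> root p z ->
  Normc.normc z ^+ n
    <= \sum_(0 <= j < n) Normc.normc p`_j * Normc.normc z ^+ j.
Proof.
move=> /monicP; rewrite lead_coefE => lp sp /rootP.
rewrite horner_coef sp -(big_mkord predT (fun j => p`_j * z ^+ j)).
rewrite big_nat_recr //=; move: lp; rewrite sp /= => ->; rewrite mul1r => /eqP.
rewrite addrC addr_eq0 => /eqP zn; rewrite -normcX zn.
rewrite (normcN (_ : Rcomplex R)) (le_trans (normc_sum_le _ _ _)) //.
by apply: ler_sum => j _; rewrite Normc.normcM normcX.
Qed.

(** The operator argument in degree [n.+3], tested on [(1, r, .., r ^+ n.+2)], whose squared norm is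
    [S]. *)
Lemma real_form_bound (R : realType) (n : nat) (f : nat -> R) (r : R) :
  (forall j, 0 <= f j) -> 0 <= r ->
  r ^+ n.+3 <= \sum_(0 <= j < n.+3) f j * r ^+ j ->
  r ^+ 2 <=
    cos (pi / n.+4%:R) ^+ 2 + f n.+1
    + 1 / 4 * (f n.+2 + Num.sqrt (\sum_(0 <= j < n.+3) f j ^+ 2)) ^+ 2
    + 1 / 2 * Num.sqrt (\sum_(0 <= j < n.+2) f j ^+ 2)
    + 1 / 2 * Num.sqrt (\sum_(0 <= j < n.+3) f j ^+ 2).
Proof.
move=> f_ge0 r_ge0 rn.
set c := cos _; set al := Num.sqrt (\sum_(0 <= j < n.+3) _).
set be := Num.sqrt _.
pose S := \sum_(0 <= j < n.+3) (r ^+ j) ^+ 2.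
have S_gt0 : 0 < S.
  rewrite /S big_nat_recl // expr0 expr1n ltr_pwDl //.
  by apply: sumr_ge0 => j _; apply: sqr_ge0.
have c_gt0 : 0 < c.
  apply: cos_gt0_pihalf; have p0 := pi_gt0 R.
  rewrite (@lt_trans _ _ 0) ?oppr_lt0 ?divr_gt0 //=.
  by rewrite ltr_pM2l // ltf_pV2 ?posrE ?ltr0n // ltr_nat.
have fal : f n.+2 <= al.
  rewrite -[f _]ger0_norm // -sqrtr_sqr ler_wsqrtr // big_nat_recr //= lerDr.
  by apply: sumr_ge0 => j _; apply: sqr_ge0.
have L2 : \sum_(0 <= j < n.+1) r ^+ j * r ^+ j.+2 <= c ^+ 2 * S.
  (* Truncating the powers kills the last two products, as the nilpotent shift does. *)
  pose t j := if (j < n.+3)%N then r ^+ j else 0.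
  have tE j : (j < n.+3)%N -> t j = r ^+ j by rewrite /t => ->.
  have t0 j : (n.+3 <= j)%N -> t j = 0 by move=> nj; rewrite /t ltnNge nj.
  have := @shift_sqr_form_le R n.+3 isT t c_gt0 (t0 _ (leqnn _)) (t0 _ (leqnSn _)).
  rewrite big_nat_recr //= big_nat_recr //= (t0 n.+3) // (t0 n.+4) // !mulr0 !addr0.
  congr (_ <= _ * _); apply: eq_big_nat => j /andP[_ jn]; rewrite !tE //.
  exact: leq_trans jn (leq_addl 2 _).
pose s := \sum_(0 <= j < n.+3) f j * r ^+ j.
pose s' := \sum_(0 <= j < n.+2) f j * r ^+ j.+1.
have LR : s * r ^+ n.+1 <= (f n.+1 + al) / 2 * S.
  exact: (@rank_one_form_le R n.+3 n.+1 f (fun j => r ^+ j)).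
have RR : s * r ^+ n.+2 <= (f n.+2 + al) / 2 * S.
  exact: (@rank_one_form_le R n.+3 n.+2 f (fun j => r ^+ j)).
(* The tail [(r, .., r ^+ n.+2)] is the test vector here; its squared norm is [S - 1], and [be]
   omits the top coefficient. *)
have RL : s' * r ^+ n.+2 <= (f n.+1 + be) / 2 * S.
  apply: le_trans (@rank_one_form_le R n.+2 n.+1 f (fun j => r ^+ j.+1) _) _ => //.
  rewrite -/be; apply: ler_wpM2l.
    by rewrite divr_ge0 // addr_ge0 // sqrtr_ge0.
  by rewrite /S [leRHS]big_nat_recl // lerDr sqr_ge0.
(* The sum is the squared shift; the two products left over come from the rows of the squared
   companion matrix that contain coefficients. *)
have rS : r ^+ 2 * S = \sum_(0 <= j < n.+1) r ^+ j * r ^+ j.+2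
    + r ^+ n.+3 * r ^+ n.+1 + r ^+ n.+4 * r ^+ n.+2.
  rewrite /S big_nat_recr //= big_nat_recr //= !mulrDr mulr_sumr.
  rewrite (eq_bigr (fun j => r ^+ j * r ^+ j.+2)).
    by rewrite !exprS; ring.
  by move=> j _; rewrite !exprS; ring.
(* The hypothesis [rn] is used twice: on [r * r ^+ n.+3], then on the power [r ^+ n.+3] in the
   resulting top term. *)
have rn1 : r ^+ n.+4 <= s' + f n.+2 * s.
  rewrite exprS (le_trans (ler_wpM2l r_ge0 rn)) // big_nat_recr //= mulrDr.
  have -> : r * \sum_(0 <= j < n.+2) f j * r ^+ j = s'.
    by rewrite /s' mulr_sumr; apply: eq_bigr => j _; rewrite exprS; ring.
  by rewrite lerD2l mulrCA -exprS ler_wpM2l.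
have e1 : r ^+ n.+3 * r ^+ n.+1 <= s * r ^+ n.+1.
  by rewrite ler_wpM2r ?exprn_ge0.
have e2 : r ^+ n.+4 * r ^+ n.+2 <= s' * r ^+ n.+2 + f n.+2 * (s * r ^+ n.+2).
  by rewrite mulrA -mulrDl ler_wpM2r ?exprn_ge0.
have e3 : f n.+2 * (s * r ^+ n.+2) <= f n.+2 * ((f n.+2 + al) / 2 * S).
  exact: ler_wpM2l.
have e4 : f n.+2 * ((f n.+2 + al) / 2 * S) <= 1 / 4 * (f n.+2 + al) ^+ 2 * S.
  rewrite mulrA ler_wpM2r ?(ltW S_gt0) // -subr_ge0.
  have -> : 1 / 4 * (f n.+2 + al) ^+ 2 - f n.+2 * ((f n.+2 + al) / 2)
    = (al - f n.+2) * (al + f n.+2) / 4 by field.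
  by rewrite divr_ge0 // mulr_ge0 ?subr_ge0 // addr_ge0 ?sqrtr_ge0.
(* The halves of [f n.+1] in [LR] and [RL] add up to the single [f n.+1] of the bound, leaving
   [al / 2] and [be / 2]. *)
rewrite -(ler_pM2r S_gt0) rS.
lra.
Qed.

Theorem theorem2p10 (R : realType) (n : nat) (p : {poly R[i]}) (z : R[i])
    (hn : (3 <= n)%N) (hmonic : p \is monic) (hdeg : size p = n.+1)
    (ha0 : p`_0 != 0) (hz : root p z) :
  Normc.normc z ^+ 2 <=
    cos (pi / n.+1%:R) ^+ 2
    + Normc.normc p`_(n - 2)
    + 1 / 4%:R * (Normc.normc p`_(n - 1)
                  + Num.sqrt (\sum_(0 <= j < n) Normc.normc p`_j ^+ 2)) ^+ 2
    + 1 / 2%:R * Num.sqrt (\sum_(0 <= j < n - 1) Normc.normc p`_j ^+ 2)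
    + 1 / 2%:R * Num.sqrt (\sum_(0 <= j < n) Normc.normc p`_j ^+ 2).
Proof.
have := @normc_root_le R n p z hmonic hdeg hz.
case: n hn {hdeg} => [|[|[|n]]] // _ rn; rewrite !subSS !subn0.
by apply: (@real_form_bound R n (fun j => Normc.normc p`_j)) => // [j|];
  apply: normc_ge0.
Qed.
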